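(* Let $\psi:\mathbb{S}_{++}^d\to\mathbb{R}$ be differentiable, strictly concave and strictly isotonic on $\mathbb{S}_{++}^d$, and let $\phi(M):=-\psi(M^{-1})$ for $M\succ 0$. Let $f$ be the associated objective function, and consider the iterates of the multiplicative algorithm with power parameter $\lambda$ applied to $\sup_{w\in\Delta_n} f(w)$. Assume that for some $k\ge 0$, the iterate $w^k$ satisfies $w^k\in\Delta_n^+$ and $\nabla_i f(w^k)>0$ for all $i\in\mathcal{I}_k$. If $w^{k+1}\neq w^k$, then for any $\lambda\in(0,1]$ we have $f(w^{k+1})>f(w^k)$.
   Context: $\mathbb{S}^d$, $\mathbb{S}_+^d$, $\mathbb{S}_{++}^d$ denote the real symmetric $d\times d$ matrices, the positive semidefinite ones, and the positive definite ones; $A\succeq B$ (resp. $A\succ B$) means $A-B\in\mathbb{S}_+^d$ (resp. $A-B\in\mathbb{S}_{++}^d$). The inner product on $\mathbb{S}^d$ is $\langle A,B\rangle=\mathrm{tr}(AB)$, and gradients are taken with respect to it. A differentiable function $\psi:\mathbb{S}_{++}^d\to\mathbb{R}$ is strictly isotonic if $0\prec A\preceq B$ and $A\neq B$ imply $\psi(A)<\psi(B)$; it is strictly concave if $A,B\succ 0$ and $A\neq B$ imply $\psi(A)<\psi(B)+\langle\nabla\psi(B),A-B\rangle$. Data: $[n]=\{1,\dots,n\}$; $A_1,\dots,A_n\in\mathbb{S}_+^d$ with $A_i\neq 0$ for all $i\in[n]$ and $\sum_{i=1}^n A_i\succ 0$. For $w\in\mathbb{R}^n$, $M(w):=\sum_{i=1}^n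 w_iA_i$. $\Delta_n:=\{w\in\mathbb{R}^n: w\ge 0,\ \sum_i w_i=1\}$, $\mathrm{ri}\,\Delta_n:=\{w>0:\sum_i w_i=1\}$, $\Delta_n^+:=\{w\in\Delta_n: M(w)\succ 0\}$. Objective: given a differentiable $\phi:\mathbb{S}_{++}^d\to\mathbb{R}$, $f(w):=\phi(M(w))$ if $M(w)\succ 0$ and $f(w):=-\infty$ otherwise. At any $w$ with $M(w)\succ0$, $f$ is differentiable with partial derivatives $\nabla_i f(w)=\langle\nabla\phi(M(w)),A_i\rangle$. Multiplicative algorithm with power parameter $\lambda\in(0,1]$: start from $w^0\in\mathrm{ri}\,\Delta_n$; at iteration $k\ge 0$, set $\bar w^k_i:=w^k_i\,(\nabla_i f(w^k))^\lambda$ for $i\in[n]$ and $w^{k+1}:=\bar w^k/\sum_{i=1}^n\bar w^k_i$. $\mathcal{I}_k:=\{i\in[n]:w^k_i>0\}$ is the support of $w^k$. *)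

(* Defs.v *)
From HB Require Import structures.
From mathcomp Require Import all_boot all_order all_algebra.
From mathcomp Require Import all_classical all_reals all_analysis.
Set Implicit Arguments.
Unset Strict Implicit.
Unset Printing Implicit Defensive.
Import Order.TTheory GRing.Theory Num.Theory.
Import numFieldNormedType.Exports.
Local Open Scope classical_set_scope.
Local Open Scope ring_scope.

Section SymmetricMatrices.
Context {R : realType} {d : nat}.
Implicit Types (A B G X : 'M[R]_d) (psi : 'M[R]_d -> R).

Definition symmx : set 'M[R]_d := [set A | A^T = A].

Definition psdmx : set 'M[R]_d :=
  [set A | symmx A /\ forall x : 'cV[R]_d, 0 <= (x^T *m A *m x) 0 0].

Definition pdmx : set 'M[R]_d :=
  [set A | symmx A /\ forall x : 'cV[R]_d, x != 0 -> 0 < (x^T *m A *m x) 0 0].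

Definition loewner_le A B : Prop := psdmx (B - A).

Definition mxinner A B : R := \tr (A *m B).

(* Functions on the positive definite matrices are represented by total        *)
(* functions on 'M[R]_d whose values off pdmx are never constrained. Hence the *)
(* derivative is taken inside the space symmx, in which pdmx is open, and not  *)
(* in 'M[R]_d: only symmetric increments X - B are considered, and the         *)
(* gradient G is required to be symmetric, which makes it unique. The norm is   *)
(* the entrywise maximum; in finite dimension little-o does not depend on it.  *)
Definition is_grad psi B G : Prop :=
  symmx G /\
  (fun X => psi X - psi B - mxinner G (X - B))
    =o_ (within symmx (nbhs B)) (fun X => X - B).

Definition grad psi B : 'M[R]_d := get [set G | is_grad psi B G].

Definition differentiable_pd psi : Prop :=
  forall B, pdmx B -> exists G, is_grad psi B G.

Definition strictly_isotonic psi : Prop :=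
  forall A B, pdmx A -> loewner_le A B -> A != B -> psi A < psi B.

Definition strictly_concave psi : Prop :=
  forall A B, pdmx A -> pdmx B -> A != B ->
    psi A < psi B + mxinner (grad psi B) (A - B).

End SymmetricMatrices.

Section Design.
Context {R : realType} {d n : nat}.
Implicit Types (A : 'I_n -> 'M[R]_d) (phi : 'M[R]_d -> R) (w : 'rV[R]_n).

Definition infomx A w : 'M[R]_d := \sum_i w 0 i *: A i.

Definition simplex : set 'rV[R]_n :=
  [set w | (forall i, 0 <= w 0 i) /\ \sum_i w 0 i = 1].

Definition ri_simplex : set 'rV[R]_n :=
  [set w | (forall i, 0 < w 0 i) /\ \sum_i w 0 i = 1].

Definition simplex_pd A : set 'rV[R]_n :=
  [set w | simplex w /\ pdmx (infomx A w)].

Definition objective phi A w : \bar R :=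
  if `[< pdmx (infomx A w) >] then (phi (infomx A w))%:E else -oo%E.

End Design.

Section MultiplicativeAlgorithm.
Context {R : realType} {n : nat}.
Implicit Types (f : 'rV[R]_n -> \bar R) (w : 'rV[R]_n) (lam : R).

(* The objective is finite on a neighbourhood of each w with M(w) positive     *)
(* definite, so fine does not affect the partial derivatives at such w.        *)
Definition partial f (i : 'I_n) w : R :=
  'D_(delta_mx 0 i) (fun v => fine (f v)) w.

Definition mult_unnorm f lam w : 'rV[R]_n :=
  \row_i (w 0 i * (partial f i w) `^ lam).

Definition mult_step f lam w : 'rV[R]_n :=
  (\sum_i mult_unnorm f lam w 0 i)^-1 *: mult_unnorm f lam w.

Definition mult_iterate f lam w0 (k : nat) : 'rV[R]_n :=
  iter k (mult_step f lam) w0.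

Definition wsupport w : set 'I_n := [set i | 0 < w 0 i].

End MultiplicativeAlgorithm.

(* Only used on pdmx, where invmx is the genuine inverse.                      *)
Definition dual_criterion {R : realType} {d : nat} (psi : 'M[R]_d -> R)
  : 'M[R]_d -> R := fun M => - psi (invmx M).

(* Main.v *)
Require Import Defs.
From HB Require Import structures.
From mathcomp Require Import all_boot all_order all_algebra.
From mathcomp Require Import all_classical all_reals all_analysis.
From mathcomp Require Import ring lra.
Set Implicit Arguments.
Unset Strict Implicit.
Unset Printing Implicit Defensive.
Import Order.TTheory GRing.Theory Num.Theory.
Import numFieldNormedType.Exports.
Local Open Scope classical_set_scope.
Local Open Scope ring_scope.

(** Write M = M(w^k), S = M^-1, M' = M(w^(k+1)), G for the gradient of psi at S,
g_i for the i-th partial derivative of f at w^k, and abbreviate w = w^k,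
w' = w^(k+1). The claim is psi(M'^-1) < psi(S).

The inverse M'^-1 depends on w' in a complicated way, but it has an upper bound
that is linear in the matrices A_i. Put N = sum_i (w_i^2 / w'_i) A_i. Completing
the square in each A_i gives M'^-1 <= S N S in the Loewner order
([invmx_infomx_le]), a matrix form of the Cauchy-Schwarz inequality. Monotonicity
and then concavity of psi give

  psi(M'^-1) <= psi(S N S) <= psi(S) + <G, S N S> - <G, S>
             = psi(S) + sum_i (w_i^2 / w'_i) g_i - sum_i w_i g_i,

because g_i = <G, S A_i S> ([partial_objective]) and S = S M S. For the
multiplicative step w'_i is proportional to w_i g_i^lam, so the first sum equals
(sum_i w_i g_i^lam) (sum_i w_i g_i^(1-lam)). As lam and 1 - lam are both
nonnegative, g^lam and g^(1-lam) are ordered alike, and Chebyshev's sum inequality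
bounds this product by sum_i w_i g_i ([powR_tradeoff]).

This last inequality is an equality for lam = 1, so strictness has to come from
psi. If both inequalities for psi were equalities, then M'^-1 = S N S = S, hence
N = M = M' and 0 = N - 2 M + M' = sum_i w'_i (w_i / w'_i - 1)^2 A_i. A vanishing
nonnegative combination of nonzero positive semidefinite matrices has zero
coefficients, so w' = w ([reweighting_lt]).

The formula for g_i needs the derivative of h |-> psi((M + h A_i)^-1) at 0. It is
obtained from the continuity of matrix inversion and from a chain rule along
curves of symmetric matrices; the set of positive definite matrices is open among
the symmetric ones, so f is finite near w in each coordinate direction. *)

(** * Quadratic forms and the Loewner order *)

Section QuadraticForms.
Context {R : realType} {d : nat}.
Implicit Types (A B M N : 'M[R]_d) (x y : 'cV[R]_d).

Definition bform A x y : R := (x^T *m A *m y) 0 0.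

Lemma bformD A B x y : bform (A + B) x y = bform A x y + bform B x y.
Proof. by rewrite /bform mulmxDr mulmxDl mxE. Qed.

Lemma bformZ c A x y : bform (c *: A) x y = c * bform A x y.
Proof. by rewrite /bform -scalemxAr -scalemxAl mxE. Qed.

Lemma bformB A B x y : bform (A - B) x y = bform A x y - bform B x y.
Proof. by rewrite bformD -scaleN1r bformZ mulN1r. Qed.

Lemma bform_sum n (A : 'I_n -> 'M[R]_d) x y :
  bform (\sum_i A i) x y = \sum_i bform (A i) x y.
Proof. by rewrite /bform mulmx_sumr mulmx_suml summxE. Qed.

Lemma bformC A x y : symmx A -> bform A x y = bform A y x.
Proof.
move=> As; rewrite /bform -[in LHS]As.
by rewrite -[in LHS](trmxK y) -!trmx_mul mxE mulmxA.
Qed.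

Lemma bformBl A x y z : bform A (x - y) z = bform A x z - bform A y z.
Proof. by rewrite /bform raddfB /= !mulmxBl !mxE. Qed.

Lemma bformBr A x y z : bform A z (x - y) = bform A z x - bform A z y.
Proof. by rewrite /bform mulmxBr !mxE. Qed.

Lemma bformZl A c x y : bform A (c *: x) y = c * bform A x y.
Proof. by rewrite /bform [(c *: x)^T]linearZ /= -!scalemxAl mxE. Qed.

Lemma bformZr A c x y : bform A x (c *: y) = c * bform A x y.
Proof. by rewrite /bform -scalemxAr mxE. Qed.

(** The form in which the square is completed throughout. *)
Lemma bform_subZ A c x y : symmx A ->
  bform A (x - c *: y) (x - c *: y) =
  bform A x x - 2 * c * bform A x y + c ^+ 2 * bform A y y.
Proof.
move=> As; rewrite !(bformBl, bformBr, bformZl, bformZr) (bformC y x As); ring.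
Qed.

Lemma bform_delta A i j : bform A (delta_mx i 0) (delta_mx j 0) = A i j.
Proof. by rewrite /bform trmx_delta -rowE -colE !mxE. Qed.

Lemma symmxD A B : symmx A -> symmx B -> symmx (A + B).
Proof. by rewrite /symmx/= => As Bs; rewrite linearD /= As Bs. Qed.

Lemma symmxZ c A : symmx A -> symmx (c *: A).
Proof. by rewrite /symmx/= => As; rewrite linearZ /= As. Qed.

Lemma symmx_sum n (A : 'I_n -> 'M[R]_d) :
  (forall i, symmx (A i)) -> symmx (\sum_i A i).
Proof.
by move=> As; rewrite /symmx/= linear_sum; apply: eq_bigr => i _; exact: As.
Qed.

Lemma symmx_inv A : symmx A -> symmx (invmx A).
Proof. by rewrite /symmx/= => As; rewrite trmx_inv As. Qed.

Lemma pd_psd A : pdmx A -> psdmx A.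
Proof.
move=> [As A0]; split=> // x; have [->|/A0/ltW//] := eqVneq x 0.
by rewrite mulmx0 mxE.
Qed.

Lemma pd_unit A : pdmx A -> A \in unitmx.
Proof.
move=> [As A0]; rewrite unitmxE unitfE; apply/negP => /det0P[v v0 vA].
have vT0 : v^T != 0.
  by apply: contra_neq v0 => /(congr1 trmx); rewrite trmxK trmx0.
by have := A0 _ vT0; rewrite trmxK vA mul0mx mxE ltxx.
Qed.

Lemma pd_inv A : pdmx A -> pdmx (invmx A).
Proof.
move=> Apd; have Au := pd_unit Apd; have [As A0] := Apd.
split=> [|x x0]; first exact: symmx_inv.
have := A0 (invmx A *m x); rewrite trmx_mul trmx_inv As.
rewrite mulmxKV// mulmxA; apply.
by apply: contra_neq x0 => /(congr1 (mulmx A)); rewrite mulKVmx// mulmx0.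
Qed.

Lemma pd_loewner_le A B : pdmx A -> loewner_le A B -> pdmx B.
Proof.
move=> [As A0] [BAs BA0]; split=> [|x x0].
  by rewrite -(subrK A B); exact: symmxD.
have := BA0 x; have := A0 x x0; rewrite -!/(bform _ x x) bformB; lra.
Qed.

(** Polarization: the entries of A are values of the bilinear form at basis
vectors. *)
Lemma bform_eq0 A : symmx A -> (forall x, bform A x x = 0) -> A = 0.
Proof.
move=> As A0; apply/matrixP => i j; rewrite mxE -bform_delta.
set x := delta_mx i 0; set y := delta_mx j 0.
have := bform_subZ 1 x y As; rewrite !A0; lra.
Qed.

(** Evaluated at x, a vanishing sum of nonnegative terms has vanishing terms; if
c i were nonzero, the quadratic form of A i would be zero. *)
Lemma psd_sum_eq0 n (A : 'I_n -> 'M[R]_d) (c : 'I_n -> R) :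
  (forall i, psdmx (A i)) -> (forall i, 0 <= c i) ->
  \sum_i c i *: A i = 0 -> forall i, A i != 0 -> c i = 0.
Proof.
move=> Apsd c0 S0 i Ai0; apply/eqP; apply: contraNT Ai0 => ci0.
apply/eqP/bform_eq0 => [|x]; first by have [] := Apsd i.
have : \sum_i c i * bform (A i) x x = 0.
  under eq_bigr do rewrite -bformZ; rewrite -bform_sum S0.
  by rewrite /bform mulmx0 mul0mx mxE.
move/eqP; rewrite psumr_eq0 => [/allP/(_ i (mem_index_enum _))/=|j _].
  by rewrite mulf_eq0 (negPf ci0) => /eqP.
by rewrite mulr_ge0//; have [_] := Apsd j; exact.
Qed.

(** The Cauchy-Schwarz inequality for the inner product defined by A, applied to x
and A^-1 e_j, whose product is x_j. Summed over j it gives a lower bound for the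
quadratic form of A by a multiple of the squared Euclidean norm. *)
Lemma pd_coord A x j : pdmx A -> x j 0 ^+ 2 <= invmx A j j * bform A x x.
Proof.
move=> Apd; have [As A0] := Apd; have Au := pd_unit Apd.
pose y : 'cV[R]_d := invmx A *m delta_mx j 0.
have Ay : A *m y = delta_mx j 0 by rewrite mulKVmx.
have xy : bform A x y = x j 0.
  by rewrite /bform -mulmxA Ay -colE !mxE.
have yy : bform A y y = invmx A j j.
  by rewrite /bform -mulmxA Ay -colE mxE mxE /y -colE mxE.
have jj : 0 < invmx A j j.
  rewrite -bform_delta; apply: (pd_inv Apd).2.
  apply/eqP => /matrixP/(_ j 0)/eqP; by rewrite !mxE !eqxx oner_eq0.
(* x minus its projection on y in the inner product defined by A *)
have := (pd_psd Apd).2 (x - (x j 0 / invmx A j j) *: y).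
rewrite -/(bform _ _ _) bform_subZ// xy yy => H.
rewrite -ler_pdivrMl// -subr_ge0; congr (0 <= _): H; field; exact: lt0r_neq0.
Qed.

End QuadraticForms.

(** * Openness of the positive definite cone *)

Section PositiveDefiniteOpen.
Context {R : realType} {d : nat}.
Implicit Types (A H X : 'M[R]_d) (x : 'cV[R]_d).

Lemma normr_bform_le H x :
  `|bform H x x| <= `|H| * (d%:R * \sum_j x j 0 ^+ 2).
Proof.
have -> : d%:R * \sum_j x j 0 ^+ 2 =
    \sum_(k < d) \sum_(j < d) (x j 0 ^+ 2 + x k 0 ^+ 2) / 2.
  under [RHS]eq_bigr do rewrite -mulr_suml big_split /= sumr_const card_ord.
  rewrite -mulr_suml big_split /= sumr_const card_ord sumrMnl.
  by rewrite -mulrnDl -[X in X / 2]mulr_natl -mulrA mulrDl -splitr.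
rewrite /bform mxE mulr_sumr (le_trans (ler_norm_sum _ _ _))//.
apply: ler_sum => k _; rewrite mxE mulr_suml mulr_sumr.
rewrite (le_trans (ler_norm_sum _ _ _))//; apply: ler_sum => j _.
have Hjk : `|H j k| <= `|H|.
  by rewrite [leRHS]/Num.Def.normr/= mx_normrE; exact: (le_bigmax _ _ (j, k)).
rewrite mxE mulrAC mulrC !normrM ler_pM// ?mulr_ge0//.
rewrite -(real_normK (num_real (x j 0))) -(real_normK (num_real (x k 0))).
have := sqr_ge0 (`|x j 0| - `|x k 0|); nra.
Qed.

(** By [pd_coord] the quadratic form q of A satisfies |x|^2 <= K q(x) with K the
trace of A^-1, and a perturbation of entrywise norm delta changes it by at most
delta d |x|^2, which is less than q(x) as soon as delta (d K + 1) <= 1. *)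
Lemma pd_near A : pdmx A -> \forall X \near A, symmx X -> pdmx X.
Proof.
move=> Apd; have [As A0] := Apd.
pose K := \sum_j invmx A j j.
have K0 : 0 <= K.
  apply: sumr_ge0 => j _; rewrite -bform_delta.
  exact: (pd_psd (pd_inv Apd)).2.
have coer x : \sum_j x j 0 ^+ 2 <= K * bform A x x.
  by rewrite mulr_suml; apply: ler_sum => j _; exact: pd_coord.
have dK0 : 0 <= d%:R * K by rewrite mulr_ge0.
have del0 : 0 < (d%:R * K + 1)^-1 by rewrite invr_gt0 ltr_wpDl.
near=> X => Xs; split=> // x x0.
have XA : `|A - X| <= (d%:R * K + 1)^-1.
  by near: X; apply: cvgr_dist_le => //; exact: cvg_id.
have q0 : 0 < bform A x x := A0 x x0.
have : `|bform (A - X) x x| < bform A x x.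
  apply: le_lt_trans (normr_bform_le _ _) _.
  apply: (@le_lt_trans _ _ ((d%:R * K + 1)^-1 * (d%:R * (K * bform A x x)))).
    rewrite ler_pM ?mulr_ge0 ?sumr_ge0// => [j _|]; first exact: sqr_ge0.
    by rewrite ler_wpM2l.
  by rewrite (mulrA d%:R) ltr_pdivrMl ?ltr_wpDl// mulrDl mul1r ltrDl.
rewrite bformB -/(bform X x x) => /(le_lt_trans (ler_norm _)); lra.
Unshelve. all: by end_near. Qed.

End PositiveDefiniteOpen.

(** * Limits of matrix-valued functions *)

Section MatrixLimits.
Context {R : realType} {T : Type} {F : set_system T} {FF : Filter F}.

Lemma cvg_mxP m n (X : T -> 'M[R]_(m, n)) (L : 'M[R]_(m, n)) :
  (forall i j, X t i j @[t --> F] --> L i j) -> X t @[t --> F] --> L.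
Proof.
move=> XL; apply/cvgrPdist_le => /= e e0; near=> t.
rewrite [leLHS]/Num.Def.normr/= mx_normrE (bigmax_le _ (ltW e0))//= => i _.
rewrite !mxE; move: i; near: t; apply: filter_forall => /= i.
exact: ((cvgrPdist_le _ _).1 (XL i.1 i.2)).
Unshelve. all: by end_near. Qed.

Lemma cvg_mx_coord m n (X : T -> 'M[R]_(m, n)) (L : 'M[R]_(m, n)) i j :
  X t @[t --> F] --> L -> X t i j @[t --> F] --> L i j.
Proof. by move=> XL; exact: cvg_comp XL (@coord_continuous R m n i j L). Qed.

Lemma cvg_mulmx m n p (X : T -> 'M[R]_(m, n)) (Y : T -> 'M[R]_(n, p))
    (K : 'M[R]_(m, n)) (L : 'M[R]_(n, p)) :
  X t @[t --> F] --> K -> Y t @[t --> F] --> L ->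
  (X t *m Y t) @[t --> F] --> K *m L.
Proof.
move=> XK YL; apply: cvg_mxP => i j; rewrite mxE.
under eq_fun do rewrite mxE.
apply: cvg_big => [|k _]; first exact: add_continuous.
by apply: cvgM; exact: cvg_mx_coord.
Qed.

Lemma cvg_mxtrace n (X : T -> 'M[R]_n) (L : 'M[R]_n) :
  X t @[t --> F] --> L -> \tr (X t) @[t --> F] --> \tr L.
Proof.
move=> XL; apply: cvg_big => [|k _]; first exact: add_continuous.
exact: cvg_mx_coord.
Qed.

Lemma cvg_det n (X : T -> 'M[R]_n) (L : 'M[R]_n) :
  (forall i j, X t i j @[t --> F] --> L i j) ->
  \det (X t) @[t --> F] --> \det L.
Proof.
move=> XL; apply: cvg_big => [|s _]; first exact: add_continuous.
apply: cvgM; first exact: cvg_cst.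
by apply: cvg_big => [|i _]; [exact: mul_continuous|exact: XL].
Qed.

(** Where the determinant is nonzero, Cramer's rule expresses the inverse by
polynomials in the entries and one division. *)
Lemma cvg_invmx n (X : T -> 'M[R]_n) (L : 'M[R]_n) : L \in unitmx ->
  X t @[t --> F] --> L -> invmx (X t) @[t --> F] --> invmx L.
Proof.
move=> Lu XL; have XLE i j := cvg_mx_coord (i := i) (j := j) XL.
have detL : \det L != 0 by move: Lu; rewrite unitmxE unitfE.
have -> : invmx L = (\det L)^-1 *: \adj L by rewrite /invmx Lu.
have : ((\det (X t))^-1 *: \adj (X t)) @[t --> F] --> (\det L)^-1 *: \adj L.
  apply: cvgZ; first by apply: cvgV => //; exact: cvg_det.
  apply: cvg_mxP => i j; rewrite !mxE; under eq_fun do rewrite !mxE.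
  apply: cvgM; first exact: cvg_cst.
  apply: cvg_det => k l; rewrite !mxE; under eq_fun do rewrite !mxE.
  exact: XLE.
have detX : \forall t \near F, \det (X t) != 0.
  exact: cvgr_neq0 (cvg_det XLE) _.
apply: cvg_trans; apply: near_eq_cvg; near=> t.
have detXt : \det (X t) != 0 by near: t.
by rewrite /invmx unitmxE unitfE detXt.
Unshelve. all: by end_near. Qed.

End MatrixLimits.

(** * The chain rule and the partial derivatives of the objective *)

Section ChainRule.
Context {R : realType} {d : nat}.
Implicit Types (psi : 'M[R]_d -> R) (B G D : 'M[R]_d).

Lemma grad_is_grad psi B : differentiable_pd psi -> pdmx B ->
  is_grad psi B (grad psi B).
Proof. by move=> dpsi /dpsi; exact: getPex. Qed.

(** The remainder of the expansion of psi at B is o(c h - B), and c h - B is O(h)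
because the slope of c converges. Only symmetric values of c are needed, since a
gradient controls psi only along symmetric increments. *)
Lemma is_grad_chain psi B G D (c : R -> 'M[R]_d) : is_grad psi B G ->
  (\forall h \near 0^', symmx (c h)) ->
  c h @[h --> 0^'] --> B ->
  h^-1 *: (c h - B) @[h --> 0^'] --> D ->
  h^-1 *: (psi (c h) - psi B) @[h --> 0^'] --> mxinner G D.
Proof.
move=> [_ /eqoP Gpsi] csym cB cD.
have inner_cvg : mxinner G (h^-1 *: (c h - B)) @[h --> 0^'] --> mxinner G D.
  by apply: cvg_mxtrace; apply: cvg_mulmx cD; exact: cvg_cst.
rewrite -[mxinner G D]addr0.
have remE h : h^-1 *: (psi (c h) - psi B) = mxinner G (h^-1 *: (c h - B)) +
    h^-1 *: (psi (c h) - psi B - mxinner G (c h - B)).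
  rewrite /mxinner -scalemxAr mxtraceZ -[h^-1 * _]/(h^-1 *: _) -scalerDr.
  by congr (_ *: _); rewrite [RHS]addrC subrK.
under eq_fun do rewrite remE.
apply: cvgD => //; apply/cvgr0Pnorm_le => /= e e0.
have K0 : 0 < `|D| + 1 by rewrite ltr_wpDl.
have Dbnd : \forall h \near 0^', `|h^-1 *: (c h - B)| <= `|D| + 1.
  have /cvgr_norm_le := cD; apply; by rewrite ltrDl.
have small : \forall h \near 0^', symmx (c h) ->
    `|psi (c h) - psi B - mxinner G (c h - B)| <= e / (`|D| + 1) * `|c h - B|.
  exact: cB _ (Gpsi _ (divr_gt0 e0 K0)).
near=> h.
have sch : symmx (c h) by near: h.
have Dh : `|h^-1 *: (c h - B)| <= `|D| + 1 by near: h.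
have /(_ sch) remh : symmx (c h) ->
    `|psi (c h) - psi B - mxinner G (c h - B)| <= e / (`|D| + 1) * `|c h - B|.
  by near: h.
rewrite normrZ (le_trans (ler_wpM2l _ remh))// mulrCA -normrZ.
by rewrite (le_trans (ler_wpM2l _ Dh)) ?divfK ?gt_eqF// divr_ge0 ?ltW.
Unshelve. all: by end_near. Qed.

End ChainRule.

Section DesignDerivative.
Context {R : realType} {d n : nat}.
Implicit Types (A : 'I_n -> 'M[R]_d) (w v : 'rV[R]_n) (psi : 'M[R]_d -> R).

Lemma infomx_shift A w h i :
  infomx A (h *: delta_mx 0 i + w) = infomx A w + h *: A i.
Proof.
rewrite /infomx; under eq_bigr do rewrite !mxE eqxx/= scalerDl.
rewrite big_split /= (bigD1 i)//= eqxx mulr1 big1 ?addr0 1?addrC// => j ji.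
by rewrite (negPf ji) mulr0 scale0r.
Qed.

Lemma infomx_sym A w : (forall i, symmx (A i)) -> symmx (infomx A w).
Proof. by move=> As; apply: symmx_sum => i; exact: symmxZ. Qed.

Lemma cvg_line (M H : 'M[R]_d) : (M + h *: H) @[h --> (0:R)^'] --> M.
Proof.
rewrite -[X in _ --> X]addr0 -(scale0r H).
by apply: cvgD; [exact: cvg_cst|apply: cvgZr_tmp; exact: nbhs_dnbhs].
Qed.

(** The resolvent identity X^-1 - M^-1 = X^-1 (M - X) M^-1 with X = M + h H turns the
slope into - X^-1 H M^-1, which converges by continuity of the inverse. *)
Lemma invmx_cvg_slope (M H : 'M[R]_d) : M \in unitmx ->
  h^-1 *: (invmx (M + h *: H) - invmx M) @[h --> 0^'] -->
  - (invmx M *m H *m invmx M).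
Proof.
move=> Mu.
have line : (M + h *: H) @[h --> (0:R)^'] --> M by exact: cvg_line.
have invl : invmx (M + h *: H) @[h --> (0:R)^'] --> invmx M.
  exact: cvg_invmx.
have lim : - (invmx (M + h *: H) *m H *m invmx M) @[h --> (0:R)^'] -->
    - (invmx M *m H *m invmx M).
  exact: cvgN (cvg_mulmx (cvg_mulmx invl (cvg_cst H)) (cvg_cst (invmx M))).
apply: cvg_trans lim; apply: near_eq_cvg.
have unitMh : \forall h \near (0:R)^', \det (M + h *: H) != 0.
  have detM : \det M != 0 by move: Mu; rewrite unitmxE unitfE.
  apply: cvgr_neq0 detM.
  by apply: cvg_det => i j; exact: (cvg_mx_coord (i := i) (j := j) line).
near=> h.
have h0 : h != 0 by near: h; exact: nbhs_dnbhs_neq.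
have Mhu : M + h *: H \in unitmx.
  by rewrite unitmxE unitfE; near: h.
apply: (scalerI h0); rewrite scalerA divff// scale1r scalerN.
have -> : invmx (M + h *: H) - invmx M =
    invmx (M + h *: H) *m (M - (M + h *: H)) *m invmx M.
  by rewrite mulmxBr mulVmx// mulmxBl mul1mx mulmxK.
by rewrite opprD addNKr mulmxN mulNmx -scalemxAr -scalemxAl.
Unshelve. all: by end_near. Qed.

(** Near 0 the curve h |-> M + h A i stays positive definite, so there the
objective is - psi of its inverse. The minus sign cancels the one in the slope of
the inverse. *)
Lemma partial_objective A psi w i :
  (forall j, symmx (A j)) -> differentiable_pd psi -> pdmx (infomx A w) ->
  partial (objective (dual_criterion psi) A) i w =
  mxinner (grad psi (invmx (infomx A w)))
    (invmx (infomx A w) *m A i *m invmx (infomx A w)).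
Proof.
move=> As dpsi Mpd; set M := infomx A w in Mpd *; set G := grad _ _.
have Mu := pd_unit Mpd.
have line : (M + h *: A i) @[h --> (0:R)^'] --> M by exact: cvg_line.
have Ms h : symmx (M + h *: A i).
  by apply: symmxD; [exact: infomx_sym|exact: symmxZ].
have slope : h^-1 *: (psi (invmx (M + h *: A i)) - psi (invmx M))
    @[h --> (0:R)^'] --> mxinner G (- (invmx M *m A i *m invmx M)).
  apply: (is_grad_chain (grad_is_grad dpsi (pd_inv Mpd))).
  - by near=> h; exact: symmx_inv.
  - exact: cvg_invmx.
  - exact: invmx_cvg_slope.
rewrite /partial /derive; apply: cvg_lim => //.
have {}slope : - (h^-1 *: (psi (invmx (M + h *: A i)) - psi (invmx M)))
    @[h --> (0:R)^'] --> mxinner G (invmx M *m A i *m invmx M).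
  have -> D : mxinner G D = - mxinner G (- D).
    by rewrite /mxinner mulmxN linearN opprK.
  exact: cvgN slope.
apply: cvg_trans slope; apply: near_eq_cvg.
have pdMh : \forall h \near (0:R)^', symmx (M + h *: A i) -> pdmx (M + h *: A i).
  exact: line _ (pd_near Mpd).
near=> h.
have /(_ (Ms h)) Mhpd : symmx (M + h *: A i) -> pdmx (M + h *: A i) by near: h.
rewrite /= /objective /dual_criterion infomx_shift -/M !asboolT//=.
by rewrite -scalerN; congr (_ *: _); rewrite opprB opprK addrC.
Unshelve. all: by end_near. Qed.

End DesignDerivative.

(** * Comparison of the information matrices of two designs *)

Section Reweighting.
Context {R : realType} {d n : nat}.
Variables (A : 'I_n -> 'M[R]_d) (w v : 'rV[R]_n).
Hypotheses (A_psd : forall i, psdmx (A i))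
  (w_ge0 : forall i, 0 <= w 0 i) (v_ge0 : forall i, 0 <= v 0 i)
  (w_dom : forall i, v 0 i = 0 -> w 0 i = 0)
  (w_pd : pdmx (infomx A w)).

(** The matrix N of the linear upper bound. Where v vanishes so does w, and the
convention x / 0 = 0 makes the corresponding term zero. *)
Definition ratiomx : 'M[R]_d := \sum_i (w 0 i ^+ 2 / v 0 i) *: A i.

Lemma infomx_bform u x y :
  bform (infomx A u) x y = \sum_i u 0 i * bform (A i) x y.
Proof. by rewrite bform_sum; apply: eq_bigr => i _; rewrite bformZ. Qed.

Lemma bform_ge0 i x : 0 <= bform (A i) x x.
Proof. exact: (A_psd i).2. Qed.

(** If the form of M(v) vanishes at x, then so does each v_i <x, A_i x>, hence each
w_i <x, A_i x>, hence the form of M(w). *)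
Lemma infomx_pd_dom : pdmx (infomx A v).
Proof.
split=> [|x x0]; first by apply: infomx_sym => i; have [] := A_psd i.
rewrite -/(bform _ x x) lt_def infomx_bform sumr_ge0 => [|i _]; last first.
  by rewrite mulr_ge0// bform_ge0.
rewrite andbT psumr_eq0 => [|i _]; last by rewrite mulr_ge0// bform_ge0.
apply: contraTN (w_pd.2 x x0) => /allP v0.
rewrite -/(bform _ x x) infomx_bform big1 ?ltxx// => i _.
have := v0 i (mem_index_enum _); rewrite /= mulf_eq0.
move=> /orP[/eqP/w_dom->|/eqP->].
  by rewrite mul0r.
by rewrite mulr0.
Qed.

(** This is where domination of w by v enters the square completion: with
r = w_i / v_i one has v_i r = w_i and v_i r^2 = w_i^2 / v_i even if v_i = 0. *)
Lemma mulr_ratio i : v 0 i * (w 0 i / v 0 i) = w 0 i.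
Proof.
have [v0|v0] := eqVneq (v 0 i) 0; last by rewrite mulrC divfK.
by rewrite v0 mul0r w_dom.
Qed.

(** With u = M(w)^-1 x and y = M(v)^-1 x, the difference of the two forms at x is
sum_i v_i q_i(y - (w_i / v_i) u), where q_i is the quadratic form of A_i: the
square terms are <x, M(v)^-1 x> and the form of N at u, and the cross term is
- 2 <y, M(w) u> = - 2 <x, M(v)^-1 x>. *)
Lemma invmx_infomx_le : loewner_le (invmx (infomx A v))
  (invmx (infomx A w) *m ratiomx *m invmx (infomx A w)).
Proof.
set M := infomx A w; set Mv := infomx A v; set S := invmx M.
have As i : symmx (A i) by have [] := A_psd i.
have Mvpd : pdmx Mv := infomx_pd_dom.
have Ss : symmx S := symmx_inv w_pd.1.
have Ns : symmx ratiomx by apply: symmx_sum => i; exact: symmxZ.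
split=> [|x].
  rewrite /symmx/= linearB /= !trmx_mul Ss Ns mulmxA.
  by rewrite (symmx_inv Mvpd.1).
rewrite -/(bform _ x x) bformB subr_ge0.
pose u := S *m x; pose y := invmx Mv *m x.
have Mvy : Mv *m y = x by rewrite mulKVmx// pd_unit.
have Mu : M *m u = x by rewrite mulKVmx// (pd_unit w_pd).
have yy : bform Mv y y = bform (invmx Mv) x x.
  by rewrite /bform -[_ *m y]mulmxA Mvy trmx_mul (symmx_inv Mvpd.1).
have yu : bform M y u = bform (invmx Mv) x x.
  by rewrite /bform -mulmxA Mu trmx_mul (symmx_inv Mvpd.1).
have -> : bform (S *m ratiomx *m S) x x = bform ratiomx u u.
  by rewrite /bform trmx_mul Ss !mulmxA.
suff : 0 <= bform Mv y y - 2 * bform M y u + bform ratiomx u u.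
  by rewrite yy yu; lra.
rewrite !infomx_bform bform_sum mulr_sumr -sumrB -big_split /=.
apply: sumr_ge0 => i _; rewrite bformZ.
have := mulr_ge0 (v_ge0 i) (bform_ge0 i (y - (w 0 i / v 0 i) *: u)).
rewrite bform_subZ//; congr (0 <= _).
rewrite expr2 -[w 0 i * _ / _]mulrA.
by move: (w 0 i / v 0 i) (mulr_ratio i) => r <-; ring.
Qed.

(** The descent step for an arbitrary new design v: it improves the criterion as soon
as the linearization of psi at M(w)^-1 does not increase along the upper bound of
[invmx_infomx_le]. Strict monotonicity and strict concavity of psi are both needed,
since either of the two estimates alone may be an equality. *)
Lemma reweighting_lt (psi : 'M[R]_d -> R) : (forall i, A i != 0) ->
  strictly_concave psi -> strictly_isotonic psi -> v != w ->
  let S := invmx (infomx A w) in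
  \sum_i (w 0 i ^+ 2 / v 0 i) * mxinner (grad psi S) (S *m A i *m S) <=
  \sum_i w 0 i * mxinner (grad psi S) (S *m A i *m S) ->
  psi (invmx (infomx A v)) < psi S.
Proof.
move=> A0 conc iso vw S.
set G := grad psi S; pose X := S *m ratiomx *m S.
have Sv_pd := pd_inv infomx_pd_dom; have S_pd : pdmx S := pd_inv w_pd.
have Sv_le : loewner_le (invmx (infomx A v)) X := invmx_infomx_le.
have X_pd : pdmx X := pd_loewner_le Sv_pd Sv_le.
have innerE (c : 'I_n -> R) : \sum_i c i * mxinner G (S *m A i *m S) =
    mxinner G (S *m (\sum_i c i *: A i) *m S).
  rewrite /mxinner mulmx_sumr mulmx_suml mulmx_sumr linear_sum.
  by apply: eq_bigr => i _; rewrite -scalemxAr -scalemxAl -scalemxAr linearZ.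
rewrite !innerE -/ratiomx -/X -/(infomx A w) [S *m infomx A w]mulVmx ?pd_unit//.
rewrite mul1mx => innerle.
(* if X differs from S, strict concavity suffices *)
have [XS|XS] := eqVneq X S; last first.
  apply: (@le_lt_trans _ _ (psi X)).
    by have [->//|SvX] := eqVneq (invmx (infomx A v)) X; exact/ltW/iso.
  apply: lt_le_trans (conc _ _ X_pd S_pd XS) _.
  by rewrite -/G /mxinner mulmxBr linearB /= gerDl subr_le0.
(* otherwise strictness comes from monotonicity, unless M(v)^-1 = X = S *)
rewrite -XS; apply: iso => //; apply: contra_neq vw => SvX.
have Mu := pd_unit w_pd.
have MvM : infomx A v = infomx A w.
  by rewrite -[LHS]invmxK SvX XS /S invmxK.
have NM : ratiomx = infomx A w.
  have := congr1 (fun Z => infomx A w *m Z *m infomx A w) XS.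
  by rewrite /X /S !mulmxA mulmxV// mul1mx mulmxKV// mul1mx.
pose c i := v 0 i * (w 0 i / v 0 i - 1) ^+ 2.
have c0 i : c i = 0.
  apply: (psd_sum_eq0 A_psd) (A0 i) => [j|]; first by rewrite mulr_ge0 ?sqr_ge0.
  transitivity (ratiomx - 2 *: infomx A w + infomx A v).
    rewrite /ratiomx /infomx scaler_sumr -sumrB -big_split /=.
    apply: eq_bigr => j _; rewrite scalerA -scalerBl -scalerDl; congr (_ *: _).
    rewrite /c expr2 -[w 0 j * _ / _]mulrA.
    by move: (w 0 j / v 0 j) (mulr_ratio j) => r <-; ring.
  by rewrite NM MvM scaler_nat mulr2n opprD addrA subrr sub0r addNr.
apply/rowP => i; have /eqP := c0 i.
rewrite mulf_eq0 sqrf_eq0 subr_eq0 => /orP[/eqP vi|/eqP wv].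
  by rewrite vi w_dom.
by rewrite -[RHS](mulr_ratio i) wv mulr1.
Qed.

End Reweighting.

(** * Chebyshev's inequality and the multiplicative step *)

(** The difference of the two sides is half of the double sum over i and j of
p_i p_j (a_i - a_j) (b_i - b_j). *)
Lemma chebyshev_sum (R : realDomainType) n (p a b : 'I_n -> R) :
  (forall i, 0 <= p i) ->
  (forall i j, 0 < p i -> 0 < p j -> 0 <= (a i - a j) * (b i - b j)) ->
  (\sum_i p i * a i) * (\sum_i p i * b i) <=
  (\sum_i p i) * \sum_i p i * (a i * b i).
Proof.
move=> p0 ab.
pose f i j := p i * p j * ((a i - a j) * (b i - b j)).
have f0 : 0 <= \sum_i \sum_j f i j.
  apply: sumr_ge0 => i _; apply: sumr_ge0 => j _; rewrite /f.
  have [->|pi] := eqVneq (p i) 0; first by rewrite !mul0r.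
  have [->|pj] := eqVneq (p j) 0; first by rewrite mulr0 mul0r.
  apply: mulr_ge0; first exact: mulr_ge0.
  by apply: ab; rewrite lt_def ?pi ?pj p0.
suff : \sum_i \sum_j f i j = 2 * ((\sum_i p i) * (\sum_i p i * (a i * b i)) -
  (\sum_i p i * a i) * (\sum_i p i * b i)) by move=> fE; lra.
have prodE (s t : 'I_n -> R) : (\sum_i s i) * (\sum_i t i) =
    \sum_i \sum_j s i * t j.
  by rewrite mulr_suml; apply: eq_bigr => i _; rewrite mulr_sumr.
rewrite mulrDr mulrN mulr_natl mulr2n [X in _ - X]mulr_natl mulr2n.
rewrite [X in _ + X - _]mulrC [X in _ - (_ + X)]mulrC !prodE.
rewrite -!big_split -sumrB /=; apply: eq_bigr => i _.
rewrite -!big_split -sumrB /=; apply: eq_bigr => j _.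
rewrite /f; ring.
Qed.

(** Both exponents are nonnegative, so the two powers of g are nondecreasing in g. *)
Lemma powR_tradeoff (R : realType) n (p g : 'I_n -> R) (lam : R) :
  0 <= lam <= 1 -> (forall i, 0 <= p i) -> \sum_i p i = 1 ->
  (forall i, 0 < p i -> 0 < g i) ->
  (\sum_i p i * g i `^ lam) * (\sum_i p i * g i `^ (1 - lam)) <=
  \sum_i p i * g i.
Proof.
move=> /andP[l0 l1] p0 p1 g0.
have -> : \sum_i p i * g i =
    (\sum_i p i) * \sum_i p i * (g i `^ lam * g i `^ (1 - lam)).
  rewrite p1 mul1r; apply: eq_bigr => i _.
  have [->|pi] := eqVneq (p i) 0; first by rewrite !mul0r.
  have gi : 0 < g i by rewrite g0// lt_def pi p0.
  by rewrite -powRD ?(gt_eqF gi) ?implybT// subrKC powRr1// ltW.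
apply: chebyshev_sum => // i j /g0/ltW gi /g0/ltW gj.
have mono := ge0_ler_powR; have l1' : 0 <= 1 - lam by rewrite subr_ge0.
have [gij|/ltW gji] := leP (g i) (g j).
  by rewrite mulr_le0// subr_le0 mono.
by rewrite mulr_ge0// subr_ge0 mono.
Qed.

Theorem proposition2 (R : realType) (d n : nat)
    (A : 'I_n -> 'M[R]_d)
    (A_psd : forall i, psdmx (A i)) (A_neq0 : forall i, A i != 0)
    (A_sum : pdmx (\sum_i A i))
    (psi : 'M[R]_d -> R)
    (psi_diff : differentiable_pd psi)
    (psi_conc : strictly_concave psi)
    (psi_iso : strictly_isotonic psi)
    (lam : R) (lam_gt0 : 0 < lam) (lam_le1 : lam <= 1)
    (w0 : 'rV[R]_n) (w0_ri : ri_simplex w0) :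
  let f := objective (dual_criterion psi) A in
  let w := mult_iterate f lam w0 in
  forall k : nat,
    simplex_pd A (w k) ->
    (forall i, wsupport (w k) i -> 0 < partial f i (w k)) ->
    w k.+1 != w k ->
    (f (w k) < f (w k.+1))%E.
Proof.
move=> f w k; rewrite [w k.+1]/(mult_step f lam (w k)).
move: (w k) => {w0_ri} u [[u0 u1] u_pd]; rewrite /wsupport/= => g0 neq.
pose g i := partial f i u; pose b i := u 0 i * g i `^ lam.
set v := mult_step f lam u in neq *.
have b_ge0 i : 0 <= b i by rewrite mulr_ge0// powR_ge0.
have b_eq0 i : b i = 0 -> u 0 i = 0.
  move/eqP; rewrite mulf_eq0 => /orP[/eqP//|gi0]; apply/eqP; apply: contraTT gi0.
  move=> ui; rewrite gt_eqF// powR_gt0// g0//.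
  by rewrite lt_def ui u0.
have sb_ge0 : 0 <= \sum_i b i by exact: sumr_ge0.
have sb_gt0 : 0 < \sum_i b i.
  rewrite lt_def sb_ge0 andbT; apply: contra_eqN u1 => /eqP/psumr_eq0P b0.
  rewrite big1 1?eq_sym ?oner_eq0// => i _; apply: b_eq0; exact: b0.
have vE i : v 0 i = b i / \sum_j b j.
  rewrite !mxE mulrC; congr (_ / _); apply: eq_bigr => j _; by rewrite !mxE.
have v_ge0 i : 0 <= v 0 i by rewrite vE divr_ge0.
have v_dom i : v 0 i = 0 -> u 0 i = 0.
  rewrite vE => /eqP; rewrite mulf_eq0 invr_eq0 (gt_eqF sb_gt0) orbF.
  by move=> /eqP/b_eq0.
have v_pd := infomx_pd_dom A_psd v_ge0 v_dom u_pd.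
rewrite /f /objective !asboolT// lte_fin ltrN2.
apply: (reweighting_lt A_psd) => //=.
have gE i : g i = mxinner (grad psi (invmx (infomx A u)))
    (invmx (infomx A u) *m A i *m invmx (infomx A u)).
  by rewrite /g partial_objective// => j; have [] := A_psd j.
under eq_bigr do rewrite -gE; under [leRHS]eq_bigr do rewrite -gE.
(* v_i is u_i g_i^lam divided by the sum of the b_i, so one factor u_i g_i^lam
   cancels *)
have -> : \sum_i u 0 i ^+ 2 / v 0 i * g i =
    (\sum_i b i) * (\sum_i u 0 i * g i `^ (1 - lam)).
  rewrite mulr_sumr; apply: eq_bigr => i _.
  have [->|ui] := eqVneq (u 0 i) 0; first by rewrite expr0n !mul0r mulr0.
  have gi : 0 < g i by rewrite g0// lt_def ui u0.
  have gl : g i `^ lam != 0 by rewrite gt_eqF// powR_gt0.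
  have {1}-> : g i = g i `^ lam * g i `^ (1 - lam).
    by rewrite -powRD ?(gt_eqF gi) ?implybT// subrKC powRr1// ltW.
  rewrite vE; move: (\sum_j b j) sb_gt0 => s s_gt0; rewrite /b; field.
  by rewrite gl ui gt_eqF.
apply: powR_tradeoff => //; by rewrite ltW.
Qed.
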